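(* Let $X$ be a real Banach space and let $A\colon X\rightrightarrows X^*$ be monotone such that $\operatorname{int}\operatorname{dom}A\neq\varnothing$. Then every norm $\times$ weak$^*$ convergent net in $\operatorname{gra}A$ is eventually bounded.
   Context: $X$ is a real Banach space with norm $\|\cdot\|$, continuous dual $X^*$ and pairing $\langle\cdot,\cdot\rangle$. A set-valued operator $A\colon X\rightrightarrows X^*$ assigns to each $x\in X$ a (possibly empty) set $Ax\subseteq X^*$; $\operatorname{gra}A=\{(x,x^* )\in X\times X^*\mid x^*\in Ax\}$ and $\operatorname{dom}A=\{x\mid Ax\neq\varnothing\}$. $A$ is monotone if $\langle x-y,x^*-y^*\rangle\ge0$ for all $(x,x^* ),(y,y^* )\in\operatorname{gra}A$. A net $(a_\alpha,a_\alpha^* )_{\alpha\in\Gamma}$ in $X\times X^*$ is norm $\times$ weak$^*$ convergent if there is $(x,x^* )\in X\times X^*$ with $a_\alpha\to x$ in norm and $a_\alpha^*\to x^*$ weak$^*$. A net $(b_\alpha)_{\alpha\in\Gamma}$ in a normed space is eventually bounded if there exist $\alpha_0\in\Gamma$ and $M\ge0$ such that $\|b_\alpha\|\le M$ for all $\alpha\succeq_\Gamma\alpha_0$ (for a net in $X\times X^*$ this means both components are eventually bounded). *)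

(* Defs.v *)
From HB Require Import structures.
From mathcomp Require Import all_boot all_order all_algebra.
From mathcomp Require Import all_classical all_reals all_analysis.

Set Implicit Arguments.
Unset Strict Implicit.
Unset Printing Implicit Defensive.

Import Order.TTheory GRing.Theory Num.Theory.
Import numFieldNormedType.Exports.

Local Open Scope classical_set_scope.
Local Open Scope ring_scope.

Section Dual.
Context {R : realType} {X : normedModType R}.

Definition dual_pred : {pred X -> R^o} :=
  [pred f : X -> R^o | `[< linear f /\ continuous f >]].

Record dual := Dual { dual_fun :> X -> R^o; _ : dual_fun \in dual_pred }.

HB.instance Definition _ := [isSub for dual_fun].
HB.instance Definition _ := [Choice of dual by <:].

Lemma dual_predP (f : X -> R^o) :
  reflect (linear f /\ continuous f) (f \in dual_pred).
Proof. exact: asboolP. Qed.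

Lemma dual_submod_closed : submod_closed dual_pred.
Proof.
split=> [|a f g].
  apply/dual_predP; split; last exact: cst_continuous.
  by move=> a x y; rewrite -[(0 : X -> R^o)]/(cst 0)/= scaler0 addr0.
move=> /dual_predP[lf cf] /dual_predP[lg cg]; apply/dual_predP; split.
  move=> b x y; have E z : (a *: f + g) z = a *: f z + g z by [].
  by rewrite !E lf lg !scalerDr !scalerA (mulrC a b) addrACA.
by move=> x; apply: cvgD; [apply: cvgZr; exact: cf|exact: cg].
Qed.

HB.instance Definition _ :=
  GRing.isSubmodClosed.Build R (X -> R^o) dual_pred dual_submod_closed.
HB.instance Definition _ := [SubChoice_isSubLmodule of dual by <:].

Lemma dual_linear (f : dual) : linear f.
Proof. by case: f => f /= /dual_predP[]. Qed.

Lemma dual_continuous (f : dual) : continuous f.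
Proof. by case: f => f /= /dual_predP[]. Qed.

HB.instance Definition _ (f : dual) :=
  GRing.isLinear.Build R X R^o _ f (@dual_linear f).

Definition dual_norm (f : dual) : R :=
  sup [set `|f x| | x in [set x : X | `|x| <= 1]].

Lemma has_sup_dual_norm (f : dual) :
  has_sup [set `|f x| | x in [set x : X | `|x| <= 1]].
Proof.
split; first by exists `|f 0|; exists 0 => //=; rewrite normr0 ler01.
have /linear_bounded_continuous/bounded_funP/(_ 1)[M fM] :=
  @dual_continuous f.
by exists M => _ [x /= x1 <-]; exact: fM.
Qed.

Lemma dual_norm_ub (f : dual) x : `|x| <= 1 -> `|f x| <= dual_norm f.
Proof.
by move=> x1; apply: ub_le_sup; [exact: (has_sup_dual_norm f).2|exists x].
Qed.

Lemma dual_norm_le (f : dual) M :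
  (forall x, `|x| <= 1 -> `|f x| <= M) -> dual_norm f <= M.
Proof.
move=> fM; apply: ge_sup; first exact: (has_sup_dual_norm f).1.
by move=> _ [x /= x1 <-]; exact: fM.
Qed.

Lemma dual_normD (f g : dual) :
  dual_norm (f + g) <= dual_norm f + dual_norm g.
Proof.
apply: dual_norm_le => x x1.
by rewrite (le_trans (ler_normD (f x) (g x)))// lerD// dual_norm_ub.
Qed.

Lemma dual_normZ (a : R) (f : dual) : dual_norm (a *: f) = `|a| * dual_norm f.
Proof.
have le b g : dual_norm (b *: g) <= `|b| * dual_norm g.
  apply: dual_norm_le => x x1.
  by rewrite [leLHS](normrM b (g x)) ler_wpM2l// dual_norm_ub.
apply/eqP; rewrite eq_le le/=; have [->|a0] := eqVneq a 0.
  rewrite normr0 mul0r; apply: le_trans (dual_norm_ub (x := 0) _ _) => //.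
  by rewrite normr0.
by rewrite -ler_pdivlMl ?normr_gt0// -normfV -{1}(scalerK a0 f) le.
Qed.

Lemma dual_norm0_eq0 (f : dual) : dual_norm f = 0 -> f = 0.
Proof.
move=> f0; apply/val_inj/funext => x /=; change (f x = 0).
have [->|x0] := eqVneq x 0; first exact: (raddf0 f).
have nx : `|x| != 0 by rewrite normr_eq0.
have : `|f (`|x|^-1 *: x)| <= 0.
  by rewrite -f0 dual_norm_ub// normrZ normfV normr_id mulVf.
rewrite normr_le0 linearZ => /eqP/(congr1 ( *:%R `|x|)).
by rewrite scaler0 scalerA mulfV// scale1r.
Qed.

HB.instance Definition _ :=
  Lmodule_isNormed.Build R dual dual_normD dual_normZ dual_norm0_eq0.

Definition pairing (x : X) (f : dual) : R := f x.

(* [dual] itself carries the norm topology. *)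
Definition weak_star : Type :=
  initial_topology (dual_fun : dual -> {ptws X -> R^o}).
HB.instance Definition _ := Topological.on weak_star.

End Dual.
Arguments dual {R} X.
Arguments weak_star {R} X.

Section Operator.
Context {R : realType} {X : normedModType R}.
Implicit Type A : X -> set (dual X).

Definition gra A : set (X * dual X) := [set p | A p.1 p.2].

Definition dom A : set X := [set x | A x !=set0].

Definition monotone_operator A := forall x y (xs ys : dual X),
  gra A (x, xs) -> gra A (y, ys) -> 0 <= pairing (x - y) (xs - ys).

End Operator.

(* A directed preorder; antisymmetry is not required. *)
Definition directed (I : Type) (le : I -> I -> Prop) :=
  [/\ inhabited I, forall i, le i i,
      forall i j k, le i j -> le j k -> le i k
    & forall i j, exists2 k, le i k & le j k].

Definition tails (I : Type) (le : I -> I -> Prop) : set_system I :=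
  filter_from [set: I] (fun i => [set j | le i j]).

Definition norm_weak_star_cvg (R : realType) (X : normedModType R) (I : Type)
    (le : I -> I -> Prop) (a : I -> X * dual X) :=
  exists (x : X) (xs : dual X),
    (fun i => (a i).1) @ tails le --> x /\
    (fun i => (a i).2 : weak_star X) @ tails le --> (xs : weak_star X).

Definition eventually_bounded (R : realType) (V : normedModType R) (I : Type)
    (le : I -> I -> Prop) (b : I -> V) :=
  exists (i0 : I) (M : R), 0 <= M /\ forall i, le i0 i -> `|b i| <= M.

(* Main.v *)
Require Import Defs.
From mathcomp Require Import all_boot all_order all_algebra.
From mathcomp Require Import all_classical all_reals all_analysis.
From mathcomp Require Import lra.

Set Implicit Arguments.
Unset Strict Implicit.
Unset Printing Implicit Defensive.

Import Order.TTheory GRing.Theory Num.Theory.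
Import numFieldNormedType.Exports.

Local Open Scope classical_set_scope.
Local Open Scope ring_scope.

(** A weak* convergent net of functionals may be unbounded in norm; what rules
this out here is a coercivity estimate for the graph of a monotone operator
(monotone_radial_bound): for some point y and constants r > 0, K >= 0,
  r * |f| <= f (a - y) + K * (1 + |a|)   for every (a, f) in the graph.

The estimate comes from the Baire category theorem.  If y lies in the domain of
A and g is in A y, then monotonicity gives f (y - a) <= g (y - a), which is at
most C * (1 + |a|) with C depending on y but not on (a, f).  So the sets of y
where the inequality f (y - a) <= n * (1 + |a|) holds on the whole graph, which
are closed as intersections of closed half-spaces, cover dom A as n varies.
The interior of dom A is not empty, hence one of these sets contains a ball
around some y, and taking the supremum of f over that ball produces the term
r * |f|.

For a net (a, f) in the graph with a --> x in norm and f --> f0 weakly*, split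
f (a - y) = f (a - x) + f (x - y).  Eventually |a - x| <= r / 2, so the first
term is at most (r / 2) * |f| and is absorbed by the left-hand side, while the
second one is eventually at most f0 (x - y) + 1.  What remains bounds |f|. *)

Section DualNorm.
Context {R : realType} {X : normedModType R}.
Implicit Type f : dual X.

Lemma le_dual_norm f (x : X) : pairing x f <= `|f| * `|x|.
Proof.
have [->|x0] := eqVneq x 0; first by rewrite /pairing raddf0 normr0 mulr0.
have nx : 0 < `|x| by rewrite normr_gt0.
have /(dual_norm_ub f) : `|(`|x|^-1 *: x)| <= 1.
  by rewrite normrZ normfV normr_id mulVf// gt_eqF.
rewrite linearZ normrM normfV normr_id ler_pdivrMl// mulrC.
by apply: le_trans; exact: ler_norm.
Qed.

Lemma dual_norm_ball_le f (r M : R) : 0 < r ->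
  (forall z : X, `|z| <= r -> pairing z f <= M) -> r * `|f| <= M.
Proof.
move=> r0 fM; rewrite -ler_pdivlMl//; apply: dual_norm_le => z z1.
rewrite ler_pdivlMl// -[r in leLHS](gtr0_norm r0) -[leLHS](normrM r (f z)).
have rz : `|r *: z| <= r by rewrite normrZ gtr0_norm// ler_piMr// ltW.
rewrite -[r * f z]/(r *: f z) -linearZ ler_norml.
apply/andP; split; last exact: fM.
by rewrite lerNl -[leLHS](raddfN f (r *: z)); apply: fM; rewrite normrN.
Qed.

End DualNorm.

(** The weak* topology is pulled back from the product topology along the
inclusion of the dual into functions, so evaluation at x is that inclusion
followed by a coordinate projection. *)
Lemma weak_star_cvg_eval (R : realType) (X : normedModType R)
    (F : set_system (weak_star X)) (f : weak_star X) (x : X) : Filter F ->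
  F --> f -> (fun g : weak_star X => pairing x g) @ F --> pairing x f.
Proof.
move=> FF Ff.
apply: (@continuous_cvg _ _ _ _ _ id (fun g : weak_star X => pairing x g)) Ff.
apply: (@continuous_comp (weak_star X) {ptws X -> R^o} R^o
  (dual_fun : dual X -> _) (fun h => h x)).
  exact: (@initial_continuous _ _ (dual_fun : dual X -> {ptws X -> R^o})).
exact: (@proj_continuous X (fun=> R^o) x).
Qed.

Lemma Baire_closed_cover (R : realType) (X : completeNormedModType R)
    (U : set X) (F : (set X)^nat) :
  open U -> U !=set0 -> (forall n, closed (F n)) -> U `<=` \bigcup_n F n ->
  exists n, interior (F n) !=set0.
Proof.
move=> oU U0 cF UF; apply: contrapT => noint.
have /Baire/(_ U U0 oU)[x [Ux FCx]] n : open (~` F n) /\ dense (~` F n).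
  split; first exact: closed_openC.
  move=> O [x Ox] oO; apply: contrapT => /set0P/negP/negPn/eqP OF.
  apply: noint; exists n, x; apply: filterS (open_nbhs_nbhs (conj oO Ox)).
  exact/subsets_disjoint.
by have [n _ Fnx] := UF x Ux; exact: FCx n I Fnx.
Qed.

(** Monotonicity gives f (y - a) <= g (y - a) for any fixed g in A y, so one
functional controls the whole graph.  The constant is an integer so that the
corresponding sets of points y form a countable cover of the domain. *)
Lemma monotone_dom_bound (R : realType) (X : normedModType R)
    (A : X -> set (dual X)) (y : X) : monotone_operator A -> dom A y ->
  exists n : nat, forall p, gra A p ->
    pairing (y - p.1) p.2 <= n%:R * (1 + `|p.1|).
Proof.
move=> mA [g Ayg]; exists (Num.truncn (`|g| * (1 + `|y|))).+1 => -[a f] /= Aaf.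
have := mA y a g f Ayg Aaf.
rewrite /pairing -[(g - f) _]/(g (y - a) - f (y - a)) subr_ge0 => /le_trans; apply.
apply: le_trans (le_dual_norm g (y - a)) _.
apply: (@le_trans _ _ (`|g| * (1 + `|y|) * (1 + `|a|))).
  rewrite -mulrA ler_wpM2l//; have := ler_normB y a.
  have := normr_ge0 y; have := normr_ge0 a; nra.
by rewrite ler_wpM2r ?addr_ge0// ltW// truncnS_gt.
Qed.

(** The sets F n below are the sublevel sets of the convex function
y |-> sup f (y - a) / (1 + |a|), the supremum being over the graph; it is finite
on the domain, and Baire's theorem makes it bounded near some point y.  Testing
f on the points y + z of a ball then recovers the norm of f. *)
Lemma monotone_radial_bound (R : realType) (X : completeNormedModType R)
    (A : X -> set (dual X)) : monotone_operator A -> interior (dom A) !=set0 ->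
  exists (y : X) (r K : R), [/\ 0 < r, 0 <= K & forall p, gra A p ->
    r * `|p.2| <= pairing (p.1 - y) p.2 + K * (1 + `|p.1|)].
Proof.
move=> mA intA.
pose F n := [set y | forall p, gra A p ->
  pairing (y - p.1) p.2 <= n%:R * (1 + `|p.1|)].
have cF n : closed (F n).
  rewrite [F n](_ : _ = \bigcap_(p in gra A)
      (fun y => pairing (y - p.1) p.2) @^-1` [set t | t <= n%:R * (1 + `|p.1|)]) //.
  apply: closed_bigI => p _; apply: preimage_closed; last exact: closed_le.
  move=> y _; apply: (@continuous_comp _ _ R^o (fun y => y - p.1) p.2).
    by apply: cvgB; [exact: cvg_id|exact: cvg_cst].
  exact: dual_continuous.
have [n [y]] : exists n, interior (F n) !=set0.
  apply: (Baire_closed_cover (open_interior (dom A)) intA cF) => y.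
  by move=> /interior_subset/(monotone_dom_bound mA)[n Fny]; exists n.
move=> /nbhs_closedballP[r /= Fr].
exists y, r%:num, n%:R; split=> // -[a f] Aaf /=.
apply: dual_norm_ball_le => // z zr.
have /Fr/(_ _ Aaf)/= : closed_ball y r%:num (y + z).
  by rewrite closed_ballE// /closed_ball_/= opprD addrA subrr add0r normrN.
rewrite /pairing !raddfB raddfD /=; lra.
Qed.

Theorem theorem3p3 (R : realType) (X : completeNormedModType R)
    (A : X -> set (dual X)) (A_monotone : monotone_operator A)
    (int_dom : interior (dom A) !=set0)
    (I : Type) (le : I -> I -> Prop) (le_directed : directed le)
    (a : I -> X * dual X) (a_gra : forall i, gra A (a i))
    (a_cvg : norm_weak_star_cvg le a) :
  eventually_bounded le (fun i => (a i).1) /\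
  eventually_bounded le (fun i => (a i).2).
Proof.
have [[i1] le_refl le_trans' le_dir] := le_directed.
have [x [f0 [ax af]]] := a_cvg.
have FF : Filter (tails le).
  apply: filter_from_filter; first by exists i1.
  move=> i j _ _; have [k ik jk] := le_dir i j.
  by exists k => // l kl; split; apply: le_trans' kl.
have [y [r [K [r0 K0 bound]]]] := monotone_radial_bound A_monotone int_dom.
have r20 : 0 < r / 2 by rewrite divr_gt0.
have ax_near : \forall i \near tails le, `|x - (a i).1| <= r / 2.
  by move/cvgrPdist_le : ax => /(_ _ r20).
have af_near : \forall i \near tails le,
    pairing (x - y) (a i).2 <= pairing (x - y) f0 + 1.
  have fxy : (fun i => pairing (x - y) (a i).2) @ tails le --> pairing (x - y) f0.
    exact: weak_star_cvg_eval af.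
  move/cvgrPdist_le : fxy => /(_ 1 ltr01).
  apply: filterS => i; rewrite ler_norml => /andP[+ _]; rewrite /=; lra.
have [i0 _ i0P] := filterI ax_near af_near.
have a1_le i : le i0 i -> `|(a i).1| <= `|x| + r / 2.
  move=> /i0P[axi _]; have := lerB_normD (a i).1 (x - (a i).1).
  by rewrite [_ + (x - _)]addrC subrK; lra.
split; exists i0.
  by exists (`|x| + r / 2); split=> //; rewrite addr_ge0// ltW.
(* The radius r / 2 leaves r / 2 of the coefficient of the dual norm after the
   term f (a - x) is absorbed. *)
pose M := `|pairing (x - y) f0| + 1 + K * (1 + (`|x| + r / 2)).
exists ((r / 2)^-1 * M); split.
  by rewrite mulr_ge0 ?invr_ge0 ?addr_ge0 ?mulr_ge0 ?addr_ge0// ltW.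
move=> i i0i; rewrite ler_pdivlMl//.
have [/= axi afi] := i0P i i0i.
have fx := le_dual_norm (a i).2 ((a i).1 - x).
have Ka : K * (1 + `|(a i).1|) <= K * (1 + (`|x| + r / 2)).
  by rewrite ler_wpM2l// lerD2l a1_le.
have fr : `|(a i).2| * `|(a i).1 - x| <= r / 2 * `|(a i).2|.
  by rewrite mulrC ler_wpM2r// distrC.
have := bound _ (a_gra i); have := ler_norm (pairing (x - y) f0).
move: afi fx Ka fr; rewrite /M /pairing !raddfB /=; lra.
Qed.
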